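(* Let $\gamma$ be a smooth closed nondegenerate curve in the equi-affine plane, parametrised by equi-affine arc-length, with equi-affine curvature $\kappa$. Then $\gamma$ is a critical point of $\int\kappa\,\mathrm{d}s$ with respect to deformations under which the total equi-affine arc-length is preserved if and only if $\gamma$ is an ellipse.
   Context: The equi-affine plane is $\mathbb{R}^2$ with area form $|u,v|=\det(u,v)$. The curve satisfies $|\gamma',\gamma''|=1$; primes denote $s$-derivatives; $\kappa$ is defined by $\gamma'''=-\kappa\gamma'$. Being a critical point of $\int\kappa\,\mathrm{d}s$ with respect to deformations preserving the total equi-affine arc-length $L=\int\mathrm{d}s$ means (Lagrange multiplier formulation) that there is a constant $\mu$ with $\delta\int\kappa\,\mathrm{d}s=\mu\,\delta L$ for all smooth variations of the closed curve. *)

(* Defs.v *)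
From Stdlib Require Import Reals.
From Coquelicot Require Import Coquelicot.
Open Scope R_scope.

Definition smooth (f : R -> R) : Prop :=
  forall (n : nat) (u : R), ex_derive (Derive_n f n) u.

Definition aff_det (x y : R -> R) (u : R) : R :=
  Derive x u * Derive (Derive y) u - Derive y u * Derive (Derive x) u.

(* Equi-affine speed ds/du = |gamma_u, gamma_uu|^(1/3)
   (only meaningful when the curve is nondegenerate, |.,.| > 0). *)
Definition aff_speed (x y : R -> R) (u : R) : R :=
  Rpower (aff_det x y u) (1/3).

Definition aff_length (x y : R -> R) (P : R) : R :=
  RInt (aff_speed x y) 0 P.

(* Derivatives with respect to equi-affine arc-length, d/ds = (1/sigma) d/du:
   tangent gamma_s and "normal" gamma_ss. *)
Definition tang1 (x y : R -> R) (u : R) : R := Derive x u / aff_speed x y u.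
Definition tang2 (x y : R -> R) (u : R) : R := Derive y u / aff_speed x y u.
Definition nrm1 (x y : R -> R) (u : R) : R :=
  Derive (tang1 x y) u / aff_speed x y u.
Definition nrm2 (x y : R -> R) (u : R) : R :=
  Derive (tang2 x y) u / aff_speed x y u.

(* Equi-affine curvature kappa = |gamma_ss, gamma_sss|; in arc-length
   parametrisation this is the kappa with gamma''' = - kappa gamma'. *)
Definition aff_curv (x y : R -> R) (u : R) : R :=
  (nrm1 x y u * Derive (nrm2 x y) u - nrm2 x y u * Derive (nrm1 x y) u)
  / aff_speed x y u.

Definition total_curv (x y : R -> R) (P : R) : R :=
  RInt (fun u => aff_curv x y u * aff_speed x y u) 0 P.

Definition periodic (f : R -> R) (P : R) : Prop := forall u, f (u + P) = f u.

(* Critical point of int kappa ds under deformations preserving total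
   equi-affine arc-length (Lagrange multiplier formulation): there is mu with
   delta int kappa ds = mu delta L for every smooth variation
   gamma_t = gamma + t V of the closed curve (V smooth, P-periodic). *)
Definition critical_total_curv (x y : R -> R) (P : R) : Prop :=
  exists mu : R, forall v w : R -> R,
    smooth v -> smooth w -> periodic v P -> periodic w P ->
    Derive (fun t => total_curv (fun u => x u + t * v u)
                                (fun u => y u + t * w u) P) 0
    = mu * Derive (fun t => aff_length (fun u => x u + t * v u)
                                       (fun u => y u + t * w u) P) 0.

(* The trace of the curve is an ellipse: the image of the unit circle under an
   invertible affine map of the plane. *)
Definition is_ellipse (x y : R -> R) : Prop :=
  exists c1 c2 a b c d : R, a * d - b * c <> 0 /\
    (forall u, exists th,
        x u = c1 + a * cos th + b * sin th /\ y u = c2 + c * cos th + d * sin th) /\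
    (forall th, exists u,
        x u = c1 + a * cos th + b * sin th /\ y u = c2 + c * cos th + d * sin th).

(* Main.v *)
(* Write [kappa = |gamma'', gamma'''|] and let [V] be a variation field.  Integrating by parts,
   the first variations are [int kappa (2 |gamma', V''| - 4/3 dD)] for the total curvature and
   [int dD / 3] for the length, where [dD = |gamma', V''| + |V', gamma''|].  For
   [V = g gamma''] criticality becomes [int g (kappa'' + kappa^2 + mu kappa) = 0], hence
   [kappa'' + kappa^2 + mu kappa = 0].  This ODE has nonconstant periodic solutions, but closedness
   of the curve rules them out: by translation invariance [kappa' gamma' - (kappa + mu) gamma'']
   is a constant vector, which makes [(kappa + mu)^2] the derivative of a periodic function, so
   [kappa = - mu].  A closed curve with constant [kappa] must have [kappa > 0] and is then an
   ellipse.  Conversely an ellipse has constant [kappa], and then the two variations are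
   proportional for every [V]. *)

Require Import Defs.
From Stdlib Require Import Reals Lra FunctionalExtensionality.
From Coquelicot Require Import Coquelicot.
Open Scope R_scope.

Local Notation "f ′" := (Derive f) (at level 2, left associativity, format "f ′").

(** * Smooth and periodic functions *)

Lemma smooth_ex_derive f u : smooth f -> ex_derive f u.
Proof. intros Hf; exact (Hf 0%nat u). Qed.

Lemma Derive_n_Derive f n : Derive_n f (S n) = Derive_n f′ n.
Proof.
  induction n as [|n IH]; [reflexivity|].
  change (Derive_n f (S (S n))) with ((Derive_n f (S n))′).
  now rewrite IH.
Qed.

Lemma smooth_Derive f : smooth f -> smooth f′.
Proof. intros Hf n u; rewrite <- Derive_n_Derive; apply Hf. Qed.

Lemma smooth_is_derive f u : smooth f -> is_derive f u (f′ u).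
Proof. intros Hf; apply Derive_correct, smooth_ex_derive, Hf. Qed.

Lemma smooth_continuous f u : smooth f -> continuous f u.
Proof. intros Hf; apply (ex_derive_continuous (V := R_NormedModule) f); now apply smooth_ex_derive. Qed.

Lemma smooth_ex_RInt f a b : smooth f -> ex_RInt f a b.
Proof. intros Hf; apply (ex_RInt_continuous (V := R_CompleteNormedModule) f); intros; now apply smooth_continuous. Qed.

(** Passes to the derivative of [f] first, whereas [Derive_n] differentiates last. In this form
    closure under sums and products is an induction on [n] over all functions. *)
Fixpoint diff_upto (n : nat) (f : R -> R) : Prop :=
  match n with
  | O => True
  | S n => (forall u, ex_derive f u) /\ diff_upto n f′
  end.

Lemma smooth_diff_upto f : smooth f <-> forall n, diff_upto n f.
Proof.
  split.
  - intros Hf n; revert f Hf; induction n as [|n IH]; intros f Hf; simpl; auto.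
    split; [intros u; now apply smooth_ex_derive|now apply IH, smooth_Derive].
  - intros Hf n; revert f Hf; induction n as [|n IH]; intros f Hf u.
    + apply (Hf 1%nat).
    + rewrite Derive_n_Derive; apply IH; intros m; apply (Hf (S m)).
Qed.

Lemma diff_upto_pred n f : diff_upto (S n) f -> diff_upto n f.
Proof.
  revert f; induction n as [|n IH]; intros f Hf; [exact I|].
  destruct Hf as [H1 H2]; split; [exact H1|now apply IH].
Qed.

Lemma diff_upto_plus n f g :
  diff_upto n f -> diff_upto n g -> diff_upto n (fun u => f u + g u).
Proof.
  revert f g; induction n as [|n IH]; intros f g Hf Hg; [exact I|].
  destruct Hf as [Hf Hf'], Hg as [Hg Hg']; split.
  - intros u; now apply (ex_derive_plus (V := R_NormedModule) f g).
  - replace ((fun u => f u + g u)′) with (fun u => f′ u + g′ u); [now apply IH|].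
    apply functional_extensionality; intros u; now rewrite Derive_plus.
Qed.

Lemma diff_upto_mult n f g :
  diff_upto n f -> diff_upto n g -> diff_upto n (fun u => f u * g u).
Proof.
  revert f g; induction n as [|n IH]; intros f g Hf Hg; [exact I|].
  (* The Leibniz rule pairs f' with g and f with g', so the undifferentiated factors are also needed
     at order [n]. *)
  pose proof (diff_upto_pred _ _ Hf) as Kf; pose proof (diff_upto_pred _ _ Hg) as Kg.
  destruct Hf as [Hf Hf'], Hg as [Hg Hg']; split.
  - intros u; now apply (ex_derive_mult f g).
  - replace ((fun u => f u * g u)′) with (fun u => f′ u * g u + f u * g′ u).
    + apply diff_upto_plus; now apply IH.
    + apply functional_extensionality; intros u; now rewrite Derive_mult.
Qed.

Lemma smooth_plus f g : smooth f -> smooth g -> smooth (fun u => f u + g u).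
Proof. rewrite !smooth_diff_upto; intros; now apply diff_upto_plus. Qed.

Lemma smooth_mult f g : smooth f -> smooth g -> smooth (fun u => f u * g u).
Proof. rewrite !smooth_diff_upto; intros; now apply diff_upto_mult. Qed.

Lemma smooth_const c : smooth (fun _ => c).
Proof.
  apply smooth_diff_upto; intros n; revert c; induction n as [|n IH]; intros c; [exact I|].
  split; [intros u; apply ex_derive_const|].
  replace ((fun _ : R => c)′) with (fun _ : R => 0); [apply IH|].
  apply functional_extensionality; intros u; now rewrite Derive_const.
Qed.

Lemma smooth_opp f : smooth f -> smooth (fun u => - f u).
Proof.
  intros Hf; replace (fun u => - f u) with (fun u => -1 * f u).
  - apply smooth_mult; [apply smooth_const|exact Hf].
  - apply functional_extensionality; intros u; ring.
Qed.

Lemma smooth_minus f g : smooth f -> smooth g -> smooth (fun u => f u - g u).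
Proof. intros Hf Hg; apply (smooth_plus f (fun u => - g u)); [exact Hf|now apply smooth_opp]. Qed.

Ltac smooth_tac :=
  repeat match goal with
  | |- smooth (fun u => @?f u + @?g u) => apply (smooth_plus f g)
  | |- smooth (fun u => @?f u - @?g u) => apply (smooth_minus f g)
  | |- smooth (fun u => @?f u * @?g u) => apply (smooth_mult f g)
  | |- smooth (fun u => @?f u / ?c) => apply (smooth_mult f (fun _ => / c))
  | |- smooth (fun u => - @?f u) => apply (smooth_opp f)
  | |- smooth (fun _ => ?c) => apply (smooth_const c)
  | |- smooth (Derive ?f) => apply (smooth_Derive f)
  | |- smooth (fun u => Derive ?f u) => apply (smooth_Derive f)
  | H : smooth ?f |- smooth ?f => exact H
  end; auto.

Lemma Derive_minus_smooth f g : smooth f -> smooth g ->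
  (fun u => f u - g u)′ = fun u => f′ u - g′ u.
Proof.
  intros Hf Hg; apply functional_extensionality; intros u.
  apply Derive_minus; now apply smooth_ex_derive.
Qed.

Lemma Derive_perturb f v t : smooth f -> smooth v ->
  (fun u => f u + t * v u)′ = fun u => f′ u + t * v′ u.
Proof.
  intros Hf Hv; apply functional_extensionality; intros u.
  rewrite Derive_plus, Derive_scal; [reflexivity|now apply smooth_ex_derive|].
  now apply smooth_ex_derive; smooth_tac.
Qed.

Lemma Derive_mult_smooth f g : smooth f -> smooth g ->
  (fun u => f u * g u)′ = fun u => f′ u * g u + f u * g′ u.
Proof.
  intros Hf Hg; apply functional_extensionality; intros u.
  apply Derive_mult; now apply smooth_ex_derive.
Qed.

(** * Periodic functions and their integrals over a period *)

Lemma periodic_Derive f P : periodic f P -> periodic f′ P.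
Proof.
  intros Hf u; unfold Derive; f_equal; apply Lim_ext; intros h.
  rewrite <- (Hf u), <- (Hf (u + h)); do 3 f_equal; ring.
Qed.

Lemma periodic_IZR f P n u : periodic f P -> f (u + IZR n * P) = f u.
Proof.
  intros Hf.
  assert (Hnat : forall m v, f (v + INR m * P) = f v).
  { induction m as [|m IH]; intros v; [simpl; f_equal; ring|].
    rewrite <- (IH v), <- (Hf (v + INR m * P)), S_INR; f_equal; ring. }
  destruct n as [|p|p].
  - f_equal; ring.
  - change (IZR (Z.pos p)) with (IPR p); rewrite <- INR_IPR; apply Hnat.
  - rewrite <- (Hnat (Pos.to_nat p) (u + _)).
    rewrite INR_IPR; change (IZR (Z.neg p)) with (- IPR p); f_equal; ring.
Qed.

Lemma periodic_bounded f P : 0 < P -> (forall u : R, continuous f u) -> periodic f P ->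
  exists M, 0 < M /\ forall u : R, Rabs (f u) <= M.
Proof.
  intros HP Hc Hf.
  destruct (continuity_ab_maj (fun u => Rabs (f u)) 0 P) as [m [Hm _]]; [lra| |].
  - intros u _; apply continuity_pt_filterlim, (continuous_comp f Rabs).
    + apply Hc.
    + apply (continuous_Rabs (f u)).
  - exists (Rabs (f m) + 1); split; [generalize (Rabs_pos (f m)); lra|].
    intros u; destruct (archimed (u / P)) as [H1 H2].
    (* [up r - 1] is the integer part of [r], so this shift brings [u] into [0, P]. *)
    rewrite <- (periodic_IZR f P (1 - up (u / P)) u Hf), minus_IZR.
    set (n := IZR (up (u / P))) in *.
    assert (u = u / P * P) by (field; lra).
    enough (Rabs (f (u + (1 - n) * P)) <= Rabs (f m)) by lra.
    apply (Hm (u + (1 - n) * P)); nra.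
Qed.

(** Integration by parts over a period: the boundary term h(P) - h(0) vanishes, so integrands matter
    only up to derivatives of periodic functions. *)
Lemma RInt_total_derivative f g h P :
  (forall u : R, continuous g u) -> smooth h -> periodic h P ->
  (forall u : R, f u = g u + h′ u) -> RInt f 0 P = RInt g 0 P.
Proof.
  intros Hg Hh Hper Hf.
  assert (E : is_RInt h′ 0 P 0).
  { replace 0 with (minus (h P) (h 0)) at 2.
    - apply (is_RInt_derive (V := R_CompleteNormedModule) h h′).
      + intros; now apply smooth_is_derive.
      + intros; now apply smooth_continuous, smooth_Derive.
    - rewrite <- (Hper 0), Rplus_0_l; apply Rminus_diag. }
  rewrite (RInt_ext f (fun u => plus (g u) (h′ u))) by (intros; apply Hf).
  rewrite (RInt_plus (V := R_CompleteNormedModule) g h′).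
  - rewrite (is_RInt_unique _ _ _ _ E); apply Rplus_0_r.
  - apply ex_RInt_continuous; auto.
  - now exists 0.
Qed.

Lemma is_derive_zero_const f u v : (forall w, is_derive f w 0) -> f u = f v.
Proof.
  intros Hf.
  destruct (MVT_gen f u v (fun _ => 0)) as [c [_ Hc]].
  - intros w _; apply Hf.
  - intros w _; apply continuity_pt_filterlim.
    apply (ex_derive_continuous (V := R_NormedModule) f); exists 0; apply Hf.
  - lra.
Qed.

(** A nondecreasing periodic function is squeezed between equal values: H(u) <= H(v) <= H(u + P) =
    H(u) for v in [u, u + P], and likewise to the left. *)
Lemma periodic_monotone_const H f P : 0 < P -> periodic H P ->
  (forall u : R, is_derive H u (f u)) -> (forall u : R, 0 <= f u) -> forall u : R, f u = 0.
Proof.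
  intros HP Hper Hd Hf.
  assert (Hmon : forall a b, a <= b -> H a <= H b).
  { intros a b Hab; destruct (MVT_gen H a b f) as [c [_ Hc]].
    - intros w _; apply Hd.
    - intros w _; apply continuity_pt_filterlim, (ex_derive_continuous (V := R_NormedModule) H).
      exists (f w); apply Hd.
    - generalize (Hf c); nra. }
  intros u; rewrite <- (is_derive_unique _ _ _ (Hd u)).
  rewrite (Derive_ext_loc H (fun _ => H u)); [apply Derive_const|].
  exists (mkposreal P HP); intros v Hv; change R in v; apply Rabs_lt_between' in Hv; simpl in Hv.
  assert (E := Hper (u - P)); replace (u - P + P) with u in E by ring.
  assert (E' := Hper u).
  destruct (Rle_dec u v).
  - generalize (Hmon u v) (Hmon v (u + P)); lra.
  - generalize (Hmon v u) (Hmon (u - P) v); lra.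
Qed.

Lemma RInt_nonneg_periodic_zero f P : 0 < P -> smooth f -> periodic f P ->
  (forall u : R, 0 <= f u) -> RInt f 0 P = 0 -> forall u : R, f u = 0.
Proof.
  intros HP Hf Hper Hpos Hint.
  set (H := (fun u => RInt f 0 u) : R -> R).
  assert (Hd : forall u : R, is_derive H u (f u)).
  { intros u; apply (is_derive_RInt f H 0 u).
    - apply filter_forall; intros w; apply (RInt_correct (V := R_CompleteNormedModule) f); now apply smooth_ex_RInt.
    - now apply smooth_continuous. }
  apply (periodic_monotone_const H f P HP); auto.
  intros u.
  (* The primitive [H] is periodic: its increment over a period has derivative f(u + P) - f(u) = 0,
     and at 0 that increment is the vanishing integral. *)
  assert (E : H (u + P) - H u = H (0 + P) - H 0).
  { apply (is_derive_zero_const (fun u => H (u + P) - H u)); intros w.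
    replace 0 with (minus (scal 1 (f (w + P))) (f w)).
    - apply (is_derive_minus (fun u => H (u + P)) H); [|apply Hd].
      apply (is_derive_comp H (fun u => u + P)); [apply Hd|].
      auto_derive; auto.
    - rewrite Hper; assert (K : forall z : R, 1 * z + - z = 0) by (intros; ring); exact (K (f w)). }
  unfold H in E at 3 4; rewrite Rplus_0_l, Hint, RInt_point in E.
  unfold zero in E; simpl in E; lra.
Qed.

(** * Curvature and length densities in an arbitrary parametrisation *)

(** The area form |(f, g), (h, k)| of two vector fields along the parameter line. On the second and
    third derivatives of an arc-length parametrised curve it is kappa. *)
Definition bracket (f g h k : R -> R) (u : R) : R := f u * k u - g u * h u.

Lemma smooth_bracket f g h k :
  smooth f -> smooth g -> smooth h -> smooth k -> smooth (bracket f g h k).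
Proof. intros; unfold bracket; smooth_tac. Qed.

Lemma periodic_bracket f g h k P : periodic f P -> periodic g P -> periodic h P ->
  periodic k P -> periodic (bracket f g h k) P.
Proof. intros Hf Hg Hh Hk u; unfold bracket; now rewrite Hf, Hg, Hh, Hk. Qed.

Lemma Derive_bracket f g h k : smooth f -> smooth g -> smooth h -> smooth k ->
  (bracket f g h k)′ = fun u => bracket f′ g′ h k u + bracket f g h′ k′ u.
Proof.
  intros Hf Hg Hh Hk; unfold bracket at 1.
  rewrite Derive_minus_smooth, !Derive_mult_smooth by smooth_tac.
  apply functional_extensionality; intros u; unfold bracket; ring.
Qed.

Lemma smooth_aff_det x y : smooth x -> smooth y -> smooth (aff_det x y).
Proof. intros; apply (smooth_bracket x′ y′ x′′ y′′); smooth_tac. Qed.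

Lemma Derive_aff_det x y : smooth x -> smooth y ->
  (aff_det x y)′ = bracket x′ y′ x′′′ y′′′.
Proof.
  intros; change (aff_det x y) with (bracket x′ y′ x′′ y′′).
  rewrite Derive_bracket by smooth_tac.
  apply functional_extensionality; intros u; unfold bracket; ring.
Qed.

(** The factor p = du/ds as a function of d = |gamma_u, gamma_uu|. The relation p^3 d = 1, with
    speed p^2 d and dp/dd = - p^4 / 3, replaces fractional powers by polynomials in p and d. *)
Definition inv_speed (d : R) : R := Rpower d (-1/3).

Lemma inv_speed_cube d : 0 < d -> inv_speed d ^ 3 * d = 1.
Proof.
  intros Hd; unfold inv_speed.
  rewrite <- Rpower_pow by (unfold Rpower; apply exp_pos).
  rewrite Rpower_mult; replace (-1 / 3 * INR 3) with (- (1)) by (simpl; field).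
  rewrite Rpower_Ropp, Rpower_1 by exact Hd; field; lra.
Qed.

Lemma Rpower_third d : 0 < d -> Rpower d (1/3) = inv_speed d ^ 2 * d.
Proof.
  intros Hd; unfold inv_speed.
  rewrite <- Rpower_pow by (unfold Rpower; apply exp_pos).
  rewrite Rpower_mult; rewrite <- (Rpower_1 d) at 3 by exact Hd.
  rewrite <- Rpower_plus; f_equal; simpl; field.
Qed.

Lemma inv_speed_pos d : 0 < inv_speed d.
Proof. apply exp_pos. Qed.

Lemma inv_speed_1 : inv_speed 1 = 1.
Proof. unfold inv_speed, Rpower; rewrite ln_1, Rmult_0_r; apply exp_0. Qed.

Lemma is_derive_inv_speed d : 0 < d -> is_derive inv_speed d (-1/3 * inv_speed d ^ 4).
Proof.
  intros Hd; unfold inv_speed at 1, Rpower; auto_derive; [exact Hd|].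
  change (exp (-1 / 3 * ln d)) with (inv_speed d).
  replace (inv_speed d ^ 4) with (inv_speed d * (inv_speed d ^ 3 * d) * / d).
  - rewrite inv_speed_cube by exact Hd; field; lra.
  - field; lra.
Qed.

Lemma is_derive_inv_speed_comp f f' u : 0 < f u -> is_derive f u f' ->
  is_derive (fun u => inv_speed (f u)) u (-1/3 * inv_speed (f u) ^ 4 * f').
Proof.
  intros Hu Hf.
  replace (-1/3 * inv_speed (f u) ^ 4 * f')
    with (scal f' (-1/3 * inv_speed (f u) ^ 4)) by apply Rmult_comm.
  apply (is_derive_comp inv_speed f); [now apply is_derive_inv_speed|exact Hf].
Qed.

(** Here [x1], [x2], [x3] stand for the derivatives of one coordinate of the curve. The first
    function is its component of gamma_s; the second, p times the first derivative, is its component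
    of gamma_ss. Everything follows from p' = - p^4 D' / 3. *)
Lemma Derive_tangent_normal (x1 x2 x3 D D1 D2 : R -> R) (u : R) :
  (forall u : R, 0 < D u) ->
  (forall u : R, is_derive x1 u (x2 u)) -> (forall u : R, is_derive x2 u (x3 u)) ->
  (forall u : R, is_derive D u (D1 u)) -> (forall u : R, is_derive D1 u (D2 u)) ->
  (fun u => x1 u * inv_speed (D u))′ u
    = x2 u * inv_speed (D u) - inv_speed (D u) ^ 4 * D1 u * x1 u / 3
  /\ (fun u => x2 u * inv_speed (D u) ^ 2 - inv_speed (D u) ^ 5 * D1 u * x1 u / 3)′ u
    = x3 u * inv_speed (D u) ^ 2 - inv_speed (D u) ^ 5 * D1 u * x2 u
      + 5/9 * inv_speed (D u) ^ 8 * D1 u ^ 2 * x1 u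
      - inv_speed (D u) ^ 5 * D2 u * x1 u / 3.
Proof.
  intros Hpos H1 H2 HD HD1.
  set (p := fun u => inv_speed (D u)).
  assert (Hp : forall u : R, is_derive p u (-1/3 * p u ^ 4 * D1 u)).
  { intros v; now apply is_derive_inv_speed_comp. }
  change (inv_speed (D u)) with (p u).
  change (fun u => x1 u * inv_speed (D u)) with (fun u => x1 u * p u).
  change (fun u => x2 u * inv_speed (D u) ^ 2 - inv_speed (D u) ^ 5 * D1 u * x1 u / 3)
    with (fun u => x2 u * p u ^ 2 - p u ^ 5 * D1 u * x1 u / 3).
  clearbody p.
  assert (E : forall (f : R -> R) (f' v : R), is_derive f v f' -> ex_derive f v) by (intros f f' v Hv; now exists f').
  split; apply is_derive_unique; auto_derive; try (repeat split; eauto);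
    change (fun u => p u) with p; change (fun u => x1 u) with x1;
    change (fun u => x2 u) with x2; change (fun u => D1 u) with D1;
    rewrite ?(is_derive_unique _ _ _ (H1 u)), ?(is_derive_unique _ _ _ (H2 u)),
      ?(is_derive_unique _ _ _ (Hp u)), ?(is_derive_unique _ _ _ (HD1 u)); field.
Qed.

(** A variation destroys the arc-length parametrisation, so kappa ds is needed in any parameter.
    With n = gamma_ss it equals |n, n_u| du, where n = p^2 gamma'' - p^5 D' gamma' / 3. Expanding
    bilinearly leaves |gamma'', gamma'''|, |gamma', gamma''| = D and |gamma', gamma'''| = D'. *)
Lemma curv_density x y u : smooth x -> smooth y ->
  (forall u, 0 < aff_det x y u) ->
  aff_curv x y u * aff_speed x y u =
    inv_speed (aff_det x y u) ^ 4
      * (bracket x′′ y′′ x′′′ y′′′ u + (aff_det x y)′′ u / 3)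
    - 5/9 * inv_speed (aff_det x y u) ^ 7 * (aff_det x y)′ u ^ 2.
Proof.
  intros Hx Hy Hpos.
  set (D := aff_det x y) in *; set (p := fun u => inv_speed (D u)).
  assert (HD : smooth D) by now apply smooth_aff_det.
  assert (Hs : forall v, aff_speed x y v = / p v).
  { intros v; unfold aff_speed; rewrite Rpower_third by apply Hpos.
    assert (E := inv_speed_cube _ (Hpos v)); fold (p v) in E; fold D; fold (p v).
    assert (0 < p v) by apply inv_speed_pos.
    apply (Rmult_eq_reg_l (p v)); [|lra]; rewrite Rinv_r by lra.
    rewrite <- E; ring. }
  assert (Hp : forall v, p v <> 0) by (intros v; apply Rgt_not_eq, inv_speed_pos).
  assert (Hn : forall f, smooth f ->
      let n := fun u => (fun u => f′ u / aff_speed x y u)′ u / aff_speed x y u in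
      (forall v, n v = f′′ v * p v ^ 2 - p v ^ 5 * D′ v * f′ v / 3) /\
      n′ u = f′′′ u * p u ^ 2 - p u ^ 5 * D′ u * f′′ u
             + 5/9 * p u ^ 8 * D′ u ^ 2 * f′ u - p u ^ 5 * D′′ u * f′ u / 3).
  { intros f Hf n.
    assert (K : forall v, n v = f′′ v * p v ^ 2 - p v ^ 5 * D′ v * f′ v / 3).
    { intros v; unfold n.
      rewrite (Derive_ext _ (fun u => f′ u * p u))
        by (intros; rewrite Hs; field; apply Hp).
      rewrite Hs; unfold p at 1.
      rewrite (proj1 (Derive_tangent_normal f′ f′′ f′′′ D D′ D′′ v Hpos
        ltac:(intros; apply smooth_is_derive; smooth_tac)
        ltac:(intros; apply smooth_is_derive; smooth_tac)
        ltac:(intros; apply smooth_is_derive; smooth_tac)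
        ltac:(intros; apply smooth_is_derive; smooth_tac))).
      fold (p v); field; apply Hp. }
    split; [exact K|].
    rewrite (Derive_ext n _ u K).
    apply (proj2 (Derive_tangent_normal f′ f′′ f′′′ D D′ D′′ u Hpos
        ltac:(intros; apply smooth_is_derive; smooth_tac)
        ltac:(intros; apply smooth_is_derive; smooth_tac)
        ltac:(intros; apply smooth_is_derive; smooth_tac)
        ltac:(intros; apply smooth_is_derive; smooth_tac))). }
  destruct (Hn x Hx) as [Nx Nx'], (Hn y Hy) as [Ny Ny'].
  unfold aff_curv, Rdiv at 1.
  rewrite Rmult_assoc, Rinv_l, Rmult_1_r
    by (rewrite Hs; apply Rinv_neq_0_compat, Hp).
  change (nrm1 x y u) with ((fun u => (fun u => x′ u / aff_speed x y u)′ u / aff_speed x y u) u).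
  change (nrm2 x y u) with ((fun u => (fun u => y′ u / aff_speed x y u)′ u / aff_speed x y u) u).
  change ((nrm1 x y)′ u) with ((fun u => (fun u => x′ u / aff_speed x y u)′ u / aff_speed x y u)′ u).
  change ((nrm2 x y)′ u) with ((fun u => (fun u => y′ u / aff_speed x y u)′ u / aff_speed x y u)′ u).
  rewrite Nx', Ny', Nx, Ny.
  fold (p u); set (q := p u).
  assert (Hq : q ^ 3 * D u = 1) by (apply inv_speed_cube, Hpos).
  assert (HD0 : D u = x′ u * y′′ u - y′ u * x′′ u) by reflexivity.
  assert (HD1 : D′ u = x′ u * y′′′ u - y′ u * x′′′ u).
  { unfold D; now rewrite Derive_aff_det. }
  (* The products q^3 D are kept apart in the expansion, to be replaced by 1. *)
  transitivity (q ^ 4 * bracket x′′ y′′ x′′′ y′′′ u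
    + q ^ 4 * (q ^ 3 * D u) * D′′ u / 3 - q ^ 7 * D′ u * D′ u / 3
    + q ^ 7 * (q ^ 3 * D u) * (1/3 - 5/9) * D′ u ^ 2).
  - rewrite HD0; unfold bracket; rewrite HD1 at 4; rewrite HD1; field.
  - rewrite Hq; field.
Qed.

(** * Differentiation under the integral sign *)

Lemma continuity_2d_section (f : R -> R -> R) t u : continuity_2d_pt f t u -> continuous (f t) u.
Proof.
  intros Hf; apply continuity_pt_filterlim, continuity_pt_locally; intros eps.
  destruct (Hf eps) as [d Hd]; exists d; intros v Hv; apply Hd; [|exact Hv].
  rewrite Rminus_diag, Rabs_R0; apply cond_pos.
Qed.

Lemma is_derive_RInt_family (phi dphi : R -> R -> R) P eps : 0 < eps ->
  (forall t u, Rabs t < eps -> is_derive (fun t => phi t u) t (dphi t u)) ->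
  (forall t u, Rabs t < eps -> continuity_2d_pt phi t u) ->
  (forall u, continuity_2d_pt dphi 0 u) ->
  is_derive (fun t => RInt (phi t) 0 P) 0 (RInt (dphi 0) 0 P).
Proof.
  intros He Hd Hc Hdc.
  assert (H0 : Rabs 0 < eps) by (rewrite Rabs_R0; exact He).
  assert (Hball : forall t, ball (0 : R) eps t -> Rabs t < eps).
  { intros t Ht; replace t with (minus t 0); [exact Ht|apply Rminus_0_r]. }
  rewrite <- (RInt_ext (fun u => (fun t => phi t u)′ 0) (dphi 0))
    by (intros u _; now apply is_derive_unique, Hd).
  apply (is_derive_RInt_param phi 0 P 0).
  - exists (mkposreal eps He); intros t Ht u _; exists (dphi t u); now apply Hd, Hball.
  - intros u _; apply (continuity_2d_pt_ext_loc dphi); [|apply Hdc].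
    exists (mkposreal eps He); intros t v Ht _; simpl in Ht; rewrite Rminus_0_r in Ht.
    symmetry; now apply is_derive_unique, Hd.
  - exists (mkposreal eps He); intros t Ht.
    apply (ex_RInt_continuous (V := R_CompleteNormedModule) (phi t)); intros u _.
    now apply continuity_2d_section, Hc, Hball.
Qed.

Lemma continuity_2d_smooth f t u : smooth f -> continuity_2d_pt (fun _ u => f u) t u.
Proof.
  intros Hf; apply (continuity_1d_2d_pt_comp f (fun _ u => u)).
  - now apply continuity_pt_filterlim, smooth_continuous.
  - apply continuity_2d_pt_id2.
Qed.

Lemma continuity_2d_pow (f : R -> R -> R) n t u :
  continuity_2d_pt f t u -> continuity_2d_pt (fun t u => f t u ^ n) t u.
Proof.
  intros Hf; apply (continuity_1d_2d_pt_comp (fun z => z ^ n) f); [|exact Hf].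
  apply derivable_continuous_pt, derivable_pt_pow.
Qed.

Lemma continuity_2d_inv_speed (f : R -> R -> R) t u : 0 < f t u ->
  continuity_2d_pt f t u -> continuity_2d_pt (fun t u => inv_speed (f t u)) t u.
Proof.
  intros Hpos Hf; apply (continuity_1d_2d_pt_comp inv_speed f); [|exact Hf].
  apply continuity_pt_filterlim, (ex_derive_continuous (V := R_NormedModule) inv_speed).
  eexists; now apply is_derive_inv_speed.
Qed.

Ltac real_eq := match goal with |- ?a = ?b => change (@eq R a b) end.

Ltac continuity_2d_tac :=
  repeat first
    [ assumption
    | apply continuity_2d_pt_const
    | apply continuity_2d_pt_id1
    | apply continuity_2d_smooth; now smooth_tac
    | apply continuity_2d_pt_plus
    | apply continuity_2d_pt_opp
    | apply continuity_2d_pt_mult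
    | apply continuity_2d_pow ].

(** The density of [curv_density] when D = 1 + t A + t^2 B and |gamma'', gamma'''| = E0 + t E1 + t^2
    E2. At t = 0 one has p = 1 and dp/dt = - A / 3, whence the term - 4/3 E0 A; the summand with
    D'^2 is of order t^2 and drops out. *)
Lemma is_derive_curv_family A B E0 E1 E2 P eps :
  smooth A -> smooth B -> smooth E0 -> smooth E1 -> smooth E2 -> 0 < eps ->
  (forall t u, Rabs t < eps -> 0 < 1 + t * A u + t ^ 2 * B u) ->
  is_derive (fun t => RInt (fun u =>
      inv_speed (1 + t * A u + t ^ 2 * B u) ^ 4
        * (E0 u + t * E1 u + t ^ 2 * E2 u + (t * A′′ u + t ^ 2 * B′′ u) * / 3)
      - 5/9 * inv_speed (1 + t * A u + t ^ 2 * B u) ^ 7 * (t * A′ u + t ^ 2 * B′ u) ^ 2) 0 P)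
    0 (RInt (fun u => E1 u + A′′ u / 3 - 4/3 * E0 u * A u) 0 P).
Proof.
  intros HA HB H0 H1 H2 He Hpos.
  set (p := fun t u => inv_speed (1 + t * A u + t ^ 2 * B u)).
  set (dp := fun t u => -1/3 * p t u ^ 4 * (A u + 2 * t * B u)).
  assert (Hp : forall t u, Rabs t < eps -> is_derive (fun t => p t u) t (dp t u)).
  { intros t u Ht; apply (is_derive_inv_speed_comp (fun t => 1 + t * A u + t ^ 2 * B u)).
    - now apply Hpos.
    - auto_derive; [auto|ring]. }
  assert (Cp : forall t u, Rabs t < eps -> continuity_2d_pt p t u).
  { intros t u Ht; apply (continuity_2d_inv_speed (fun t u => 1 + t * A u + t ^ 2 * B u)).
    - now apply Hpos.
    - continuity_2d_tac. }
  assert (Cdp : forall t u, Rabs t < eps -> continuity_2d_pt dp t u).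
  { intros t u Ht; specialize (Cp t u Ht); unfold dp; continuity_2d_tac. }
  assert (Z : Rabs 0 < eps) by (rewrite Rabs_R0; exact He).
  set (dphi := fun t u =>
    4 * p t u ^ 3 * dp t u
      * (E0 u + t * E1 u + t ^ 2 * E2 u + (t * A′′ u + t ^ 2 * B′′ u) * / 3)
    + p t u ^ 4 * (E1 u + 2 * t * E2 u + (A′′ u + 2 * t * B′′ u) * / 3)
    - 5/9 * (7 * p t u ^ 6 * dp t u * (t * A′ u + t ^ 2 * B′ u) ^ 2
      + p t u ^ 7 * (2 * (t * A′ u + t ^ 2 * B′ u) * (A′ u + 2 * t * B′ u)))).
  rewrite (RInt_ext _ (dphi 0)).
  2:{ intros u _; unfold dphi, dp; real_eq.
      replace (p 0 u) with 1; [field|].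
      unfold p; rewrite <- inv_speed_1 at 1; f_equal; ring. }
  apply (is_derive_RInt_family (fun t u => p t u ^ 4
      * (E0 u + t * E1 u + t ^ 2 * E2 u + (t * A′′ u + t ^ 2 * B′′ u) * / 3)
    - 5/9 * p t u ^ 7 * (t * A′ u + t ^ 2 * B′ u) ^ 2) dphi P eps He).
  - intros t u Ht; specialize (Hp t u Ht).
    assert (ex_derive (fun t => p t u) t) by (now exists (dp t u)).
    unfold dphi; clearbody p dp; auto_derive; [auto|].
    rewrite (is_derive_unique (fun t : R => p t u) t _ Hp); field.
  - intros t u Ht; specialize (Cp t u Ht); continuity_2d_tac.
  - intros u; specialize (Cp 0 u Z); specialize (Cdp 0 u Z); unfold dphi; continuity_2d_tac.
Qed.

(** The speed D^(1/3) is written p^2 D; its derivative at t = 0 is - 2/3 A + A = A / 3. *)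
Lemma is_derive_length_family A B P eps : smooth A -> smooth B -> 0 < eps ->
  (forall t u, Rabs t < eps -> 0 < 1 + t * A u + t ^ 2 * B u) ->
  is_derive (fun t => RInt (fun u => inv_speed (1 + t * A u + t ^ 2 * B u) ^ 2
      * (1 + t * A u + t ^ 2 * B u)) 0 P)
    0 (RInt (fun u => A u / 3) 0 P).
Proof.
  intros HA HB He Hpos.
  set (p := fun t u => inv_speed (1 + t * A u + t ^ 2 * B u)).
  set (dp := fun t u => -1/3 * p t u ^ 4 * (A u + 2 * t * B u)).
  assert (Hp : forall t u, Rabs t < eps -> is_derive (fun t => p t u) t (dp t u)).
  { intros t u Ht; apply (is_derive_inv_speed_comp (fun t => 1 + t * A u + t ^ 2 * B u)).
    - now apply Hpos.
    - auto_derive; [auto|ring]. }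
  assert (Cp : forall t u, Rabs t < eps -> continuity_2d_pt p t u).
  { intros t u Ht; apply (continuity_2d_inv_speed (fun t u => 1 + t * A u + t ^ 2 * B u)).
    - now apply Hpos.
    - continuity_2d_tac. }
  assert (Z : Rabs 0 < eps) by (rewrite Rabs_R0; exact He).
  set (dphi := fun t u => 2 * p t u * dp t u * (1 + t * A u + t ^ 2 * B u)
    + p t u ^ 2 * (A u + 2 * t * B u)).
  rewrite (RInt_ext _ (dphi 0)).
  2:{ intros u _; unfold dphi, dp; real_eq.
      replace (p 0 u) with 1; [field|].
      unfold p; rewrite <- inv_speed_1 at 1; f_equal; ring. }
  apply (is_derive_RInt_family (fun t u => p t u ^ 2 * (1 + t * A u + t ^ 2 * B u)) dphi P eps He).
  - intros t u Ht; specialize (Hp t u Ht).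
    assert (ex_derive (fun t => p t u) t) by (now exists (dp t u)).
    unfold dphi; clearbody p dp; auto_derive; [auto|].
    rewrite (is_derive_unique (fun t : R => p t u) t _ Hp); ring.
  - intros t u Ht; specialize (Cp t u Ht); continuity_2d_tac.
  - intros u; specialize (Cp 0 u Z); unfold dphi, dp; continuity_2d_tac.
Qed.

(** * First variation formulas *)

(** The first variation dD of |gamma', gamma''| in the direction V = (v, w). *)
Definition det_var1 (x y v w : R -> R) (u : R) : R :=
  bracket x′ y′ v′′ w′′ u + bracket v′ w′ x′′ y′′ u.

Lemma smooth_det_var1 x y v w : smooth x -> smooth y -> smooth v -> smooth w ->
  smooth (det_var1 x y v w).
Proof.
  intros; unfold det_var1.
  apply (smooth_plus (bracket x′ y′ v′′ w′′) (bracket v′ w′ x′′ y′′));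
    apply smooth_bracket; smooth_tac.
Qed.

Lemma periodic_det_var1 x y v w P : periodic x P -> periodic y P -> periodic v P ->
  periodic w P -> periodic (det_var1 x y v w) P.
Proof.
  intros Hx Hy Hv Hw u; unfold det_var1.
  rewrite !periodic_bracket; auto using periodic_Derive.
Qed.

Lemma aff_det_perturb x y v w t u : smooth x -> smooth y -> smooth v -> smooth w ->
  aff_det (fun u => x u + t * v u) (fun u => y u + t * w u) u
  = aff_det x y u + t * det_var1 x y v w u + t ^ 2 * aff_det v w u.
Proof.
  intros; unfold aff_det, det_var1, bracket.
  rewrite !Derive_perturb by smooth_tac; ring.
Qed.

(** Nearby curves stay nondegenerate, uniformly in [u]: if a and b bound A and B, then |t| (1 + a +
    b) < 1 gives t^2 <= |t|, and the perturbation is at most |t| (a + b) < 1. *)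
Lemma det_family_pos A B P : 0 < P -> smooth A -> smooth B -> periodic A P -> periodic B P ->
  exists eps, 0 < eps /\ forall t u, Rabs t < eps -> 0 < 1 + t * A u + t ^ 2 * B u.
Proof.
  intros HP HA HB PA PB.
  destruct (periodic_bounded A P HP) as [a [Ha HAa]]; auto.
  { intros; now apply smooth_continuous. }
  destruct (periodic_bounded B P HP) as [b [Hb HBb]]; auto.
  { intros; now apply smooth_continuous. }
  exists (/ (1 + a + b)); split; [apply Rinv_0_lt_compat; lra|].
  intros t u Ht; specialize (HAa u); specialize (HBb u).
  assert (Hm : Rabs t * (1 + a + b) < 1).
  { apply (Rmult_lt_compat_r (1 + a + b)) in Ht; [|lra].
    rewrite Rinv_l in Ht; lra. }
  assert (H0 := Rabs_pos t).
  assert (H1 : Rabs (t * A u) <= Rabs t * a).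
  { rewrite Rabs_mult; now apply Rmult_le_compat_l. }
  assert (H2 : Rabs (t ^ 2 * B u) <= Rabs t * b).
  { rewrite Rabs_mult, <- RPow_abs.
    assert (Rabs t ^ 2 <= Rabs t) by nra.
    apply Rmult_le_compat; auto using Rabs_pos; nra. }
  apply Rabs_le_between in H1; apply Rabs_le_between in H2; nra.
Qed.

Lemma Derive_affine_comb p a b f g : smooth f -> smooth g ->
  (fun u => p + a * f u + b * g u)′ = fun u => a * f′ u + b * g′ u.
Proof.
  intros Hf Hg; apply functional_extensionality; intros u.
  rewrite !Derive_plus, Derive_const, !Derive_scal;
    try (apply smooth_ex_derive; smooth_tac); ring.
Qed.

Lemma Derive_lin_comb a b f g : smooth f -> smooth g ->
  (fun u => a * f u + b * g u)′ = fun u => a * f′ u + b * g′ u.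
Proof.
  intros Hf Hg; apply functional_extensionality; intros u.
  rewrite !Derive_plus, !Derive_scal;
    try (apply smooth_ex_derive; smooth_tac); ring.
Qed.

Lemma Derive_locally_eq (f g : R -> R) l eps : 0 < eps ->
  (forall t, Rabs t < eps -> f t = g t) -> is_derive g 0 l -> f′ 0 = l.
Proof.
  intros He Hfg Hg.
  rewrite (Derive_ext_loc f g); [now apply is_derive_unique|].
  exists (mkposreal eps He); intros t Ht; apply Hfg.
  replace t with (minus t 0); [exact Ht|apply Rminus_0_r].
Qed.

(** Along gamma + t V both |gamma', gamma''| and |gamma'', gamma'''| are quadratic polynomials in t,
    so for small t the two functionals are the families differentiated above. *)
Lemma first_variation x y v w P : 0 < P ->
  smooth x -> smooth y -> smooth v -> smooth w ->
  periodic x P -> periodic y P -> periodic v P -> periodic w P ->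
  (forall u, aff_det x y u = 1) ->
  Derive (fun t => aff_length (fun u => x u + t * v u) (fun u => y u + t * w u) P) 0
    = RInt (fun u => det_var1 x y v w u / 3) 0 P /\
  Derive (fun t => total_curv (fun u => x u + t * v u) (fun u => y u + t * w u) P) 0
    = RInt (fun u => bracket x′′ y′′ v′′′ w′′′ u + bracket v′′ w′′ x′′′ y′′′ u
        + (det_var1 x y v w)′′ u / 3
        - 4/3 * bracket x′′ y′′ x′′′ y′′′ u * det_var1 x y v w u) 0 P.
Proof.
  intros HP Hx Hy Hv Hw Px Py Pv Pw Hdet.
  assert (HA : smooth (det_var1 x y v w)) by now apply smooth_det_var1.
  assert (HB : smooth (aff_det v w)) by now apply smooth_aff_det.
  assert (HD : forall t, aff_det (fun u => x u + t * v u) (fun u => y u + t * w u)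
      = fun u => 1 + t * det_var1 x y v w u + t ^ 2 * aff_det v w u).
  { intros t; apply functional_extensionality; intros u.
    now rewrite aff_det_perturb, Hdet. }
  destruct (det_family_pos (det_var1 x y v w) (aff_det v w) P) as [eps [He Hpos]]; auto.
  { now apply periodic_det_var1. }
  { apply (periodic_bracket v′ w′ v′′ w′′); auto using periodic_Derive. }
  split.
  - eapply (Derive_locally_eq _ _ _ eps He);
      [|apply (is_derive_length_family _ _ P eps HA HB He Hpos)].
    intros t Ht; apply RInt_ext; intros u _; unfold aff_speed.
    rewrite Rpower_third; rewrite HD; [reflexivity|now apply Hpos].
  - eapply (Derive_locally_eq _ _ _ eps He);
      [|apply (is_derive_curv_family (det_var1 x y v w) (aff_det v w)
          (bracket x′′ y′′ x′′′ y′′′)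
          (fun u => bracket x′′ y′′ v′′′ w′′′ u + bracket v′′ w′′ x′′′ y′′′ u)
          (bracket v′′ w′′ v′′′ w′′′) P eps)]; auto;
      try (apply (smooth_plus (bracket x′′ y′′ v′′′ w′′′) (bracket v′′ w′′ x′′′ y′′′)));
      try (apply smooth_bracket; smooth_tac).
    intros t Ht; apply RInt_ext; intros u _.
    rewrite curv_density; try (smooth_tac; fail).
    + rewrite HD, Derive_affine_comb, Derive_lin_comb by smooth_tac.
      unfold bracket; rewrite !Derive_perturb by smooth_tac; real_eq; field.
    + intros s; rewrite HD; now apply Hpos.
Qed.

(** Differentiating |gamma', gamma''| = 1 gives |gamma', gamma'''| = 0, so in the frame gamma',
    gamma'' the vector gamma''' has only a gamma' component, namely |gamma''', gamma''| = -
    kappa. *)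
Lemma third_derivative x y : smooth x -> smooth y -> (forall u, aff_det x y u = 1) ->
  forall u, x′′′ u = - bracket x′′ y′′ x′′′ y′′′ u * x′ u
    /\ y′′′ u = - bracket x′′ y′′ x′′′ y′′′ u * y′ u.
Proof.
  intros Hx Hy Hdet u; unfold bracket.
  assert (H0 : x′ u * y′′ u - y′ u * x′′ u = 1) by apply Hdet.
  assert (H1 : x′ u * y′′′ u - y′ u * x′′′ u = 0).
  { change (bracket x′ y′ x′′′ y′′′ u = 0); rewrite <- Derive_aff_det by assumption.
    rewrite (Derive_ext _ (fun _ => 1) u Hdet); apply Derive_const. }
  split.
  - transitivity (x′′′ u * (x′ u * y′′ u - y′ u * x′′ u)
      - x′′ u * (x′ u * y′′′ u - y′ u * x′′′ u)); [rewrite H0, H1|]; ring.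
  - transitivity (y′′′ u * (x′ u * y′′ u - y′ u * x′′ u)
      - y′′ u * (x′ u * y′′′ u - y′ u * x′′′ u)); [rewrite H0, H1|]; ring.
Qed.

(* Integration by parts: [|gamma'', V'''| + |V'', gamma'''| = 2 kappa |gamma', V''| + |gamma'', V''|']. *)
Lemma first_variation_curv x y v w P : 0 < P ->
  smooth x -> smooth y -> smooth v -> smooth w ->
  periodic x P -> periodic y P -> periodic v P -> periodic w P ->
  (forall u, aff_det x y u = 1) ->
  Derive (fun t => total_curv (fun u => x u + t * v u) (fun u => y u + t * w u) P) 0
    = RInt (fun u => bracket x′′ y′′ x′′′ y′′′ u
        * (2 * bracket x′ y′ v′′ w′′ u - 4/3 * det_var1 x y v w u)) 0 P.
Proof.
  intros HP Hx Hy Hv Hw Px Py Pv Pw Hdet.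
  rewrite (proj2 (first_variation x y v w P HP Hx Hy Hv Hw Px Py Pv Pw Hdet)).
  assert (HA : smooth (det_var1 x y v w)) by now apply smooth_det_var1.
  assert (PA : periodic (det_var1 x y v w) P) by now apply periodic_det_var1.
  assert (HG : smooth (bracket x′′ y′′ v′′ w′′)) by (apply smooth_bracket; smooth_tac).
  assert (Hk : smooth (bracket x′′ y′′ x′′′ y′′′)) by (apply smooth_bracket; smooth_tac).
  assert (Hq : smooth (bracket x′ y′ v′′ w′′)) by (apply smooth_bracket; smooth_tac).
  (* The total derivative split off is that of |gamma'', V''| + dD' / 3. *)
  apply (RInt_total_derivative _ _
    (fun u => bracket x′′ y′′ v′′ w′′ u + /3 * (det_var1 x y v w)′ u)).
  - intros u; apply smooth_continuous; smooth_tac.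
  - smooth_tac.
  - intros u; rewrite (periodic_Derive _ _ PA); f_equal.
    apply periodic_bracket; auto using periodic_Derive.
  - intros u; destruct (third_derivative x y Hx Hy Hdet u) as [Ex Ey].
    rewrite Derive_perturb by smooth_tac; rewrite Derive_bracket by smooth_tac.
    assert (E : bracket v′′ w′′ x′′′ y′′′ u + bracket x′′′ y′′′ v′′ w′′ u = 0)
      by (unfold bracket; ring).
    assert (E' : bracket x′′′ y′′′ v′′ w′′ u
      = - bracket x′′ y′′ x′′′ y′′′ u * bracket x′ y′ v′′ w′′ u).
    { set (k := bracket x′′ y′′ x′′′ y′′′ u) in *; unfold bracket; rewrite Ex, Ey; ring. }
    apply Rminus_diag_uniq.
    transitivity (bracket v′′ w′′ x′′′ y′′′ u + bracket x′′′ y′′′ v′′ w′′ u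
      - 2 * (bracket x′′′ y′′′ v′′ w′′ u
        + bracket x′′ y′′ x′′′ y′′′ u * bracket x′ y′ v′′ w′′ u)).
    + field.
    + rewrite E, E'; ring.
Qed.

(** * Euler–Lagrange equation and its solutions *)

(** The relation gamma''' = - k gamma' keeps all derivatives of V = g gamma'' in the frame gamma',
    gamma''; these are the frame components of V''. *)
Lemma Derive_normal_field x g k : smooth x -> smooth g -> smooth k ->
  (forall u, x′′′ u = - k u * x′ u) ->
  (fun u => g u * x′′ u)′′
  = fun u => (g′′ u - g u * k u) * x′′ u - (2 * g′ u * k u + g u * k′ u) * x′ u.
Proof.
  intros Hx Hg Hk H3.
  assert (E : x′′′ = fun u => - (k u * x′ u)).
  { apply functional_extensionality; intros u; rewrite H3; ring. }
  rewrite (Derive_mult_smooth g x′′), E by smooth_tac.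
  replace (fun u => g′ u * x′′ u + g u * - (k u * x′ u))
    with (fun u => g′ u * x′′ u - (g u * k u) * x′ u)
    by (apply functional_extensionality; intros; ring).
  rewrite Derive_minus_smooth, !Derive_mult_smooth, E by smooth_tac.
  apply functional_extensionality; intros u.
  replace ((fun u => g u * k u)′ u) with (g′ u * k u + g u * k′ u); [ring|].
  now rewrite Derive_mult_smooth.
Qed.

Lemma euler_lagrange x y P mu : 0 < P -> smooth x -> smooth y ->
  periodic x P -> periodic y P -> (forall u, aff_det x y u = 1) ->
  let k := bracket x′′ y′′ x′′′ y′′′ in
  (forall v w : R -> R, smooth v -> smooth w -> periodic v P -> periodic w P ->
    Derive (fun t => total_curv (fun u => x u + t * v u) (fun u => y u + t * w u) P) 0
    = mu * Derive (fun t => aff_length (fun u => x u + t * v u) (fun u => y u + t * w u) P) 0) ->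
  forall u, k′′ u + k u ^ 2 + mu * k u = 0.
Proof.
  intros HP Hx Hy Px Py Hdet k Hcrit.
  assert (Hk : smooth k) by (apply smooth_bracket; smooth_tac).
  assert (Pk : periodic k P) by (apply periodic_bracket; auto using periodic_Derive).
  assert (H3 := third_derivative x y Hx Hy Hdet).
  (* The test field is [e * gamma''] where [e] is the Euler-Lagrange expression itself. *)
  set (e := fun u => k′′ u + k u * k u + mu * k u).
  assert (He : smooth e) by (unfold e; smooth_tac).
  assert (Pe : periodic e P).
  { intros u; unfold e; now rewrite (periodic_Derive _ _ (periodic_Derive _ _ Pk)), Pk. }
  set (v := fun u => e u * x′′ u); set (w := fun u => e u * y′′ u).
  assert (Hv : smooth v) by (unfold v; smooth_tac).
  assert (Hw : smooth w) by (unfold w; smooth_tac).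
  assert (Pv : periodic v P).
  { intros u; unfold v; now rewrite Pe, (periodic_Derive _ _ (periodic_Derive _ _ Px)). }
  assert (Pw : periodic w P).
  { intros u; unfold w; now rewrite Pe, (periodic_Derive _ _ (periodic_Derive _ _ Py)). }
  assert (D1 : forall u, x′ u * y′′ u - y′ u * x′′ u = 1) by exact Hdet.
  assert (Ev := Derive_normal_field x e k Hx He Hk (fun u => proj1 (H3 u))).
  assert (Ew := Derive_normal_field y e k Hy He Hk (fun u => proj2 (H3 u))).
  fold v in Ev; fold w in Ew.
  assert (Q : forall u, bracket x′ y′ v′′ w′′ u = e′′ u - e u * k u).
  { intros u; unfold bracket; rewrite Ev, Ew.
    transitivity ((e′′ u - e u * k u) * (x′ u * y′′ u - y′ u * x′′ u)); [ring|].
    rewrite D1; ring. }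
  (* Since V' = e' gamma'' - e k gamma', the second part |V', gamma''| of dD is - e k. *)
  assert (A : forall u, det_var1 x y v w u = e′′ u - 2 * (e u * k u)).
  { intros u; unfold det_var1; rewrite Q; unfold bracket, v, w.
    rewrite !Derive_mult_smooth by smooth_tac.
    destruct (H3 u) as [-> ->]; fold k.
    transitivity (e′′ u - e u * k u - e u * k u * (x′ u * y′′ u - y′ u * x′′ u)); [ring|].
    rewrite D1; ring. }
  specialize (Hcrit v w Hv Hw Pv Pw).
  rewrite first_variation_curv, (proj1 (first_variation x y v w P HP Hx Hy Hv Hw Px Py Pv Pw Hdet))
    in Hcrit by assumption.
  fold k in Hcrit.
  (* The curvature integrand is 2/3 (k e'' + k^2 e), and k e'' - k'' e is the derivative of k e' -
     k' e. *)
  rewrite (RInt_total_derivative _ (fun u => 2/3 * (e u * (k′′ u + k u * k u)))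
    (fun u => 2/3 * (k u * e′ u - k′ u * e u))) in Hcrit.
  2:{ intros; apply smooth_continuous; smooth_tac. }
  2:{ smooth_tac. }
  2:{ intros u; now rewrite Pk, Pe, (periodic_Derive _ _ Pk), (periodic_Derive _ _ Pe). }
  2:{ intros u; rewrite Q, A, Derive_scal, Derive_minus_smooth, !Derive_mult_smooth by smooth_tac.
      field. }
  rewrite (RInt_total_derivative (fun u => det_var1 x y v w u / 3) (fun u => - 2/3 * (e u * k u))
    (fun u => /3 * e′ u)) in Hcrit.
  2:{ intros; apply smooth_continuous; smooth_tac. }
  2:{ smooth_tac. }
  2:{ intros u; now rewrite (periodic_Derive _ _ Pe). }
  2:{ intros u; rewrite A, Derive_scal; field. }
  assert (S1 : smooth (fun u => 2/3 * (e u * (k′′ u + k u * k u)))) by smooth_tac.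
  assert (S2 : smooth (fun u => - 2/3 * (e u * k u))) by smooth_tac.
  (* The criticality equation now says that 2/3 e (k'' + k^2 + mu k) = 2/3 e^2 has integral zero. *)
  assert (Z : forall u, 2/3 * (e u * e u) = 0).
  { apply (RInt_nonneg_periodic_zero (fun u => 2/3 * (e u * e u)) P HP).
    - smooth_tac.
    - intros u; now rewrite Pe.
    - intros u; generalize (Rle_0_sqr (e u)); unfold Rsqr; lra.
    - rewrite (RInt_ext _ (fun u => minus (2/3 * (e u * (k′′ u + k u * k u)))
          (scal mu (- 2/3 * (e u * k u))))).
      2:{ intros u _; unfold e at 2; change (2/3 * (e u * (k′′ u + k u * k u + mu * k u))
            = 2/3 * (e u * (k′′ u + k u * k u)) - mu * (- 2/3 * (e u * k u))); field. }
      rewrite (RInt_minus (V := R_CompleteNormedModule)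
        (fun u => 2/3 * (e u * (k′′ u + k u * k u))) (fun u => scal mu (- 2/3 * (e u * k u)))).
      + rewrite (RInt_scal (V := R_CompleteNormedModule) (fun u => - 2/3 * (e u * k u))).
        * apply Rminus_diag_eq; exact Hcrit.
        * now apply smooth_ex_RInt.
      + now apply smooth_ex_RInt.
      + apply (ex_RInt_scal (V := R_NormedModule)); now apply smooth_ex_RInt. }
  intros u; specialize (Z u).
  assert (E : e u * e u = 0) by lra.
  apply Rmult_integral in E; unfold e in E; simpl; destruct E; lra.
Qed.

(* Translation invariance makes [J = kappa' gamma' - (kappa + mu) gamma''] constant, so that
   [kappa + mu = |J, gamma'|]; hence [(kappa + mu)^2] is the derivative of a periodic function. *)
Lemma euler_lagrange_const x y P mu : 0 < P -> smooth x -> smooth y ->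
  periodic x P -> periodic y P -> (forall u, aff_det x y u = 1) ->
  let k := bracket x′′ y′′ x′′′ y′′′ in
  (forall u, k′′ u + k u ^ 2 + mu * k u = 0) -> forall u, k u = - mu.
Proof.
  intros HP Hx Hy Px Py Hdet k HEL.
  assert (Hk : smooth k) by (apply smooth_bracket; smooth_tac).
  assert (Pk : periodic k P) by (apply periodic_bracket; auto using periodic_Derive).
  assert (H3 := third_derivative x y Hx Hy Hdet).
  set (J := fun (z : R -> R) u => k′ u * z′ u - (k u + mu) * z′′ u).
  assert (HJ : forall z, smooth z -> (forall u, z′′′ u = - k u * z′ u) ->
      forall u, J z u = J z 0).
  { intros z Hz Ez u; apply is_derive_zero_const; intros s.
    replace 0 with ((J z)′ s); [apply smooth_is_derive; unfold J; smooth_tac|].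
    unfold J; rewrite Derive_minus_smooth, !Derive_mult_smooth by smooth_tac.
    rewrite Ez, Derive_plus, Derive_const by (apply smooth_ex_derive; smooth_tac).
    generalize (HEL s); intros K.
    transitivity ((k′′ s + k s ^ 2 + mu * k s) * z′ s); [ring|rewrite K; ring]. }
  assert (Jx := HJ x Hx (fun u => proj1 (H3 u))).
  assert (Jy := HJ y Hy (fun u => proj2 (H3 u))).
  assert (Z : forall u, (k u + mu) ^ 2 = 0).
  { apply (periodic_monotone_const
      (fun u => - k′ u - mu * (J y 0 * x u - J x 0 * y u)) (fun u => (k u + mu) ^ 2) P HP).
    - intros u; now rewrite Px, Py, (periodic_Derive _ _ Pk).
    - intros u.
      replace ((k u + mu) ^ 2)
        with ((fun u => - k′ u - mu * (J y 0 * x u - J x 0 * y u))′ u);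
        [apply smooth_is_derive; smooth_tac|].
      rewrite Derive_minus, Derive_opp, Derive_scal, Derive_minus, !Derive_scal
        by (apply smooth_ex_derive; smooth_tac).
      rewrite <- (Jx u), <- (Jy u); unfold J.
      assert (D1 : x′ u * y′′ u - y′ u * x′′ u = 1) by apply Hdet.
      generalize (HEL u); intros K.
      transitivity (- (k′′ u + k u ^ 2 + mu * k u) + k u ^ 2 + mu * k u
        + mu * (k u + mu) * (x′ u * y′′ u - y′ u * x′′ u)); [ring|].
      rewrite K, D1; ring.
    - intros u; apply pow2_ge_0. }
  intros u; specialize (Z u); nra.
Qed.

(** The multiplier is - c, as kappa = - mu demands. The two integrands then differ by c (|gamma',
    V''| - |V', gamma''|), the derivative of - c |V', gamma'|. *)
Lemma const_curv_critical x y P c : 0 < P -> smooth x -> smooth y ->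
  periodic x P -> periodic y P -> (forall u, aff_det x y u = 1) ->
  (forall u, bracket x′′ y′′ x′′′ y′′′ u = c) -> critical_total_curv x y P.
Proof.
  intros HP Hx Hy Px Py Hdet Hc; exists (- c); intros v w Hv Hw Pv Pw.
  rewrite first_variation_curv, (proj1 (first_variation x y v w P HP Hx Hy Hv Hw Px Py Pv Pw Hdet))
    by assumption.
  assert (HA : smooth (det_var1 x y v w)) by now apply smooth_det_var1.
  transitivity (RInt (fun u => scal (- c) (det_var1 x y v w u / 3)) 0 P).
  2:{ apply (RInt_scal (V := R_CompleteNormedModule) (fun u => det_var1 x y v w u / 3)).
      apply smooth_ex_RInt; smooth_tac. }
  assert (Hb : smooth (bracket v′ w′ x′ y′)) by (apply smooth_bracket; smooth_tac).
  apply (RInt_total_derivative _ _ (fun u => - c * bracket v′ w′ x′ y′ u)).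
  - intros u; apply smooth_continuous.
    change (smooth (fun u => - c * (det_var1 x y v w u / 3))); smooth_tac.
  - smooth_tac.
  - intros u; f_equal; apply periodic_bracket; auto using periodic_Derive.
  - intros u; rewrite Hc, Derive_scal, Derive_bracket by smooth_tac.
    change (scal (- c) (det_var1 x y v w u / 3)) with (- c * (det_var1 x y v w u / 3)).
    unfold det_var1, bracket; field.
Qed.

(** * Curves of constant curvature *)

(** The vector (g, w f) rotates with angular speed w; turned back by the angle w u it is
    constant. *)
Lemma rotation_invariants (f g : R -> R) (w u : R) :
  (forall s : R, is_derive f s (g s)) -> (forall s : R, is_derive g s (- (w * w) * f s)) ->
  g u * cos (w * u) + w * f u * sin (w * u) = g 0 /\
  g u * sin (w * u) - w * f u * cos (w * u) = - w * f 0.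
Proof.
  intros Hf Hg; split.
  - transitivity (g 0 * cos (w * 0) + w * f 0 * sin (w * 0));
      [|rewrite Rmult_0_r, cos_0, sin_0; ring].
    apply (is_derive_zero_const (fun u => g u * cos (w * u) + w * f u * sin (w * u))); intros s.
    auto_derive; [repeat split; eexists; eauto|].
    change (fun x : R => f x) with f; change (fun x : R => g x) with g.
    rewrite (is_derive_unique _ _ _ (Hf s)), (is_derive_unique _ _ _ (Hg s)); ring.
  - transitivity (g 0 * sin (w * 0) - w * f 0 * cos (w * 0));
      [|rewrite Rmult_0_r, cos_0, sin_0; ring].
    apply (is_derive_zero_const (fun u => g u * sin (w * u) - w * f u * cos (w * u))); intros s.
    auto_derive; [repeat split; eexists; eauto|].
    change (fun x : R => f x) with f; change (fun x : R => g x) with g.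
    rewrite (is_derive_unique _ _ _ (Hf s)), (is_derive_unique _ _ _ (Hg s)); ring.
Qed.

(** Since f'' + w^2 f is constant, it suffices to know f'', which the rotation of (f'', w f')
    supplies. *)
Lemma harmonic_solution f w : 0 < w -> smooth f -> (forall u, f′′′ u = - (w * w) * f′ u) ->
  forall u, f u = (f 0 + f′′ 0 / (w * w)) + - (f′′ 0 / (w * w)) * cos (w * u)
    + f′ 0 / w * sin (w * u).
Proof.
  intros Hw Hf E u.
  assert (C0 : f′′ u + w * w * f u = f′′ 0 + w * w * f 0).
  { apply (is_derive_zero_const (fun u => f′′ u + w * w * f u)); intros s.
    replace 0 with ((fun u => f′′ u + w * w * f u)′ s);
      [apply smooth_is_derive; smooth_tac|].
    rewrite Derive_perturb, E by smooth_tac; real_eq; ring. }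
  destruct (rotation_invariants f′ f′′ w u) as [C1 C2].
  { intros s; apply smooth_is_derive; smooth_tac. }
  { intros s; rewrite <- E; apply smooth_is_derive; smooth_tac. }
  assert (T : Rsqr (sin (w * u)) + Rsqr (cos (w * u)) = 1) by apply sin2_cos2.
  assert (F : f′′ u = f′′ 0 * cos (w * u) - w * f′ 0 * sin (w * u)).
  { rewrite <- C1 at 1; replace (w * f′ 0) with (- (- w * f′ 0)) by ring; rewrite <- C2.
    unfold Rsqr in T.
    transitivity (f′′ u * (sin (w * u) * sin (w * u) + cos (w * u) * cos (w * u)));
      [rewrite T; ring|ring]. }
  rewrite F in C0; apply (Rmult_eq_reg_l (w * w)); [|nra].
  transitivity (f′′ 0 + w * w * f 0 - (f′′ 0 * cos (w * u) - w * f′ 0 * sin (w * u)));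
    [lra|field; lra].
Qed.

(** For c <= 0 the periodic function f' f'' has derivative f''^2 - c f'^2 >= 0, so both squares
    contribute zero. *)
Lemma periodic_harmonic_trivial f P c : 0 < P -> c <= 0 -> smooth f -> periodic f P ->
  (forall u, f′′′ u = - c * f′ u) -> forall u, f′′ u = 0.
Proof.
  intros HP Hc Hf Pf E.
  assert (Z : forall u, f′′ u * f′′ u + - c * (f′ u * f′ u) = 0).
  { apply (periodic_monotone_const (fun u => f′ u * f′′ u) _ P HP).
    - intros u; now rewrite (periodic_Derive _ _ Pf), (periodic_Derive _ _ (periodic_Derive _ _ Pf)).
    - intros u; replace (f′′ u * f′′ u + - c * (f′ u * f′ u)) with ((fun u => f′ u * f′′ u)′ u);
        [apply smooth_is_derive; smooth_tac|].
      rewrite Derive_mult_smooth, E by smooth_tac; ring.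
    - intros u; generalize (Rle_0_sqr (f′ u)) (Rle_0_sqr (f′′ u)); unfold Rsqr; nra. }
  intros u; specialize (Z u); generalize (Rle_0_sqr (f′ u)); unfold Rsqr; intros.
  assert (f′′ u * f′′ u <= 0) by nra; nra.
Qed.

Lemma const_curv_ellipse x y P c : 0 < P -> smooth x -> smooth y ->
  periodic x P -> periodic y P -> (forall u, aff_det x y u = 1) ->
  (forall u, bracket x′′ y′′ x′′′ y′′′ u = c) -> is_ellipse x y.
Proof.
  intros HP Hx Hy Px Py Hdet Hc.
  assert (Ex : forall u, x′′′ u = - c * x′ u).
  { intros u; rewrite <- (Hc u); now apply third_derivative. }
  assert (Ey : forall u, y′′′ u = - c * y′ u).
  { intros u; rewrite <- (Hc u); now apply third_derivative. }
  assert (D1 : x′ 0 * y′′ 0 - y′ 0 * x′′ 0 = 1) by apply Hdet.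
  (* For c <= 0 closedness would force gamma'' = 0, against |gamma', gamma''| = 1. *)
  destruct (Rle_lt_dec c 0) as [Hneg|Hpos].
  { rewrite (periodic_harmonic_trivial x P c HP Hneg Hx Px Ex),
      (periodic_harmonic_trivial y P c HP Hneg Hy Py Ey) in D1; lra. }
  set (w := sqrt c).
  assert (Hw : 0 < w) by now apply sqrt_lt_R0.
  assert (Hww : w * w = c) by (apply sqrt_sqrt; lra).
  rewrite <- Hww in Ex, Ey.
  assert (Sx := harmonic_solution x w Hw Hx Ex).
  assert (Sy := harmonic_solution y w Hw Hy Ey).
  (* With w^2 = kappa, the centre is gamma + gamma'' / kappa and the conjugate semi-axes are -
     gamma'' / kappa and gamma' / w, all at 0. Their determinant is |gamma', gamma''| / w^3. *)
  exists (x 0 + x′′ 0 / (w * w)), (y 0 + y′′ 0 / (w * w)),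
    (- (x′′ 0 / (w * w))), (x′ 0 / w), (- (y′′ 0 / (w * w))), (y′ 0 / w).
  split; [|split].
  - replace (- (x′′ 0 / (w * w)) * (y′ 0 / w) - x′ 0 / w * - (y′′ 0 / (w * w)))
      with ((x′ 0 * y′′ 0 - y′ 0 * x′′ 0) / (w * w * w)) by (field; lra).
    rewrite D1; apply Rgt_not_eq, Rdiv_lt_0_compat; [lra|].
    repeat apply Rmult_lt_0_compat; exact Hw.
  - intros u; exists (w * u); auto.
  - intros th; exists (th / w).
    replace th with (w * (th / w)) at 2 3 5 6 by (field; lra); auto.
Qed.

(* With [w = |X, X'|] one has [X' = w X^perp] on the circle and [|X', X''| = w^3], so [w] is constant. *)
Lemma unit_circle_curv X Y m : smooth X -> smooth Y ->
  (forall u, X u * X u + Y u * Y u = 1) -> (forall u, aff_det X Y u = m) ->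
  exists c, forall u, X′′′ u = - c * X′ u /\ Y′′′ u = - c * Y′ u.
Proof.
  intros HX HY Hcirc Hdet.
  assert (C1 : forall u, X u * X′ u + Y u * Y′ u = 0).
  { intros u; assert (E : (fun u => X u * X u + Y u * Y u)′ u = 0).
    { rewrite (Derive_ext _ (fun _ => 1) u Hcirc); apply Derive_const. }
    rewrite Derive_plus, !Derive_mult in E by (apply smooth_ex_derive; smooth_tac); lra. }
  assert (C2 : forall u, X′ u * X′ u + Y′ u * Y′ u + (X u * X′′ u + Y u * Y′′ u) = 0).
  { intros u; assert (E : (fun u => X u * X′ u + Y u * Y′ u)′ u = 0).
    { rewrite (Derive_ext _ (fun _ => 0) u C1); apply Derive_const. }
    rewrite Derive_plus, !Derive_mult in E by (apply smooth_ex_derive; smooth_tac); lra. }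
  set (w := bracket X Y X′ Y′).
  (* Lagrange's identity, for a unit vector orthogonal to its derivative. *)
  assert (Hsq : forall u, X′ u * X′ u + Y′ u * Y′ u = w u * w u).
  { intros u; unfold w, bracket.
    transitivity ((X u * X u + Y u * Y u) * (X′ u * X′ u + Y′ u * Y′ u)
      - (X u * X′ u + Y u * Y′ u) * (X u * X′ u + Y u * Y′ u)); [rewrite Hcirc, C1|]; ring. }
  assert (DX : forall u, X′ u = - w u * Y u).
  { intros u; unfold w, bracket.
    transitivity ((X u * X u + Y u * Y u) * X′ u - X u * (X u * X′ u + Y u * Y′ u));
      [rewrite Hcirc, C1|]; ring. }
  assert (DY : forall u, Y′ u = w u * X u).
  { intros u; unfold w, bracket.
    transitivity ((X u * X u + Y u * Y u) * Y′ u - Y u * (X u * X′ u + Y u * Y′ u));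
      [rewrite Hcirc, C1|]; ring. }
  assert (Hm : forall u, w u * (w u * w u) = m).
  { intros u; rewrite <- (Hdet u); unfold aff_det.
    transitivity (- w u * (X u * X′′ u + Y u * Y′′ u)).
    - rewrite <- Hsq; generalize (C2 u); intros K.
      replace (X u * X′′ u + Y u * Y′′ u) with (- (X′ u * X′ u + Y′ u * Y′ u)) by lra; ring.
    - rewrite (DX u), (DY u); ring. }
  (* Cubing is injective: the cofactor a^2 + a b + b^2 in a^3 - b^3 is positive unless a = b = 0. *)
  assert (Hconst : forall u, w u = w 0).
  { intros u; assert (K : w u * (w u * w u) = w 0 * (w 0 * w 0)) by (now rewrite !Hm).
    destruct (Rtotal_order (w u) (w 0)) as [H|[H|H]]; [exfalso|exact H|exfalso];
      assert (0 < (w u - w 0) * (w u - w 0)) by nra;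
      assert (0 < w u * w u + w u * w 0 + w 0 * w 0)
        by (generalize (Rle_0_sqr (w u + w 0)) (Rle_0_sqr (w u)) (Rle_0_sqr (w 0));
            unfold Rsqr; nra);
      nra. }
  assert (FX : X′ = fun u => - w 0 * Y u).
  { apply functional_extensionality; intros u; now rewrite DX, Hconst. }
  assert (FY : Y′ = fun u => w 0 * X u).
  { apply functional_extensionality; intros u; now rewrite DY, Hconst. }
  assert (FX2 : X′′ = fun u => - (w 0 * w 0) * X u).
  { apply functional_extensionality; intros u; rewrite FX, Derive_scal, FY; ring. }
  assert (FY2 : Y′′ = fun u => - (w 0 * w 0) * Y u).
  { apply functional_extensionality; intros u; rewrite FY, Derive_scal, FX; ring. }
  exists (w 0 * w 0); intros u; rewrite FX2, FY2, !Derive_scal; now split.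
Qed.

(** The inverse affine map carries the curve to the unit circle and scales |gamma', gamma''| to the
    constant 1 / q. The equation gamma''' = - k gamma' found there is linear, so it transfers back
    with the same k. *)
Lemma ellipse_const_curv x y : smooth x -> smooth y -> (forall u, aff_det x y u = 1) ->
  is_ellipse x y -> exists c, forall u, bracket x′′ y′′ x′′′ y′′′ u = c.
Proof.
  intros Hx Hy Hdet (c1 & c2 & a & b & c & d & Hinv & Hon & _).
  set (q := a * d - b * c) in *.
  set (X := fun u => - (d * c1 - b * c2) / q + d / q * x u + - b / q * y u).
  set (Y := fun u => - (a * c2 - c * c1) / q + - c / q * x u + a / q * y u).
  assert (HX : smooth X) by (unfold X; smooth_tac).
  assert (HY : smooth Y) by (unfold Y; smooth_tac).
  assert (Hcirc : forall u, X u * X u + Y u * Y u = 1).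
  { intros u; destruct (Hon u) as [th [Ex Ey]].
    assert (EX : X u = cos th) by (unfold X; rewrite Ex, Ey; unfold q; field; exact Hinv).
    assert (EY : Y u = sin th) by (unfold Y; rewrite Ex, Ey; unfold q; field; exact Hinv).
    rewrite EX, EY, Rplus_comm; apply sin2_cos2. }
  assert (HdetXY : forall u, aff_det X Y u = / q).
  { intros u; unfold aff_det, X, Y.
    rewrite !Derive_affine_comb, !Derive_lin_comb by smooth_tac.
    transitivity ((a * d - b * c) / (q * q) * aff_det x y u).
    - unfold aff_det; field; exact Hinv.
    - rewrite Hdet; fold q; field; exact Hinv. }
  destruct (unit_circle_curv X Y (/ q) HX HY Hcirc HdetXY) as [k Hk].
  assert (Fx : x = fun u => c1 + a * X u + b * Y u).
  { apply functional_extensionality; intros u; unfold X, Y, q; field; exact Hinv. }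
  assert (Fy : y = fun u => c2 + c * X u + d * Y u).
  { apply functional_extensionality; intros u; unfold X, Y, q; field; exact Hinv. }
  exists k; intros u.
  assert (Ex : x′′′ u = - k * x′ u).
  { rewrite Fx, Derive_affine_comb, !Derive_lin_comb by smooth_tac.
    destruct (Hk u) as [-> ->]; ring. }
  assert (Ey : y′′′ u = - k * y′ u).
  { rewrite Fy, Derive_affine_comb, !Derive_lin_comb by smooth_tac.
    destruct (Hk u) as [-> ->]; ring. }
  unfold bracket; rewrite Ex, Ey.
  transitivity (k * aff_det x y u); [unfold aff_det; ring|rewrite Hdet; ring].
Qed.

Theorem theorem5 (x y : R -> R) (L : R) :
  0 < L ->
  smooth x -> smooth y ->
  periodic x L -> periodic y L ->
  (forall u, aff_det x y u = 1) ->
  L = aff_length x y L ->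
  (critical_total_curv x y L <-> is_ellipse x y).
Proof.
  intros HL Hx Hy Px Py Hdet _; split.
  - intros [mu Hmu].
    apply (const_curv_ellipse x y L (- mu)); try assumption.
    apply (euler_lagrange_const x y L mu); try assumption.
    now apply (euler_lagrange x y L mu).
  - intros He; destruct (ellipse_const_curv x y Hx Hy Hdet He) as [c Hc].
    now apply (const_curv_critical x y L c).
Qed.
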